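(* Consider the closed-loop system consisting of the state equation $\dot x(t)=f(x(t),u(t))$, $x(0)=x_0$, and the controller equation $$\dot u(t)=\Big(\frac{\partial g}{\partial u}(x(t),u(t))\Big)^{-1}\Big(r(t+T)-\hat y(t+T)+\dot r(t+T)-\frac{\partial g}{\partial x}(x(t),u(t))\,f(x(t),u(t))\Big),$$ where $\hat y(t+T)=g(x(t),u(t))$, and define $V(x(t),u(t)):=\frac12\|r(t+T)-\hat y(t+T)\|^2$. If the trajectory $\{(x(t),u(t)):t\ge 0\}$ of the closed-loop system is nonsingular, then $V$ satisfies $$\dot V(x(t),u(t))=-2V(x(t),u(t)),$$ and consequently $$\lim_{t\to\infty}\big(r(t)-\hat y(t)\big)=0.$$
   Context: Setting: $x(t)\in\mathbb R^n$ is the state, $u(t)\in\mathbb R^m$ the control input, $y(t)=h(x(t))\in\mathbb R^m$ the output, $r(t)\in\mathbb R^m$ the reference signal, and $T>0$ a fixed lookahead time. Standing assumptions. (1) $f:\mathbb R^n\times\mathbb R^m\to\mathbb R^n$ is continuously differentiable, and for every compact set $\Gamma\subset\mathbb R^m$ there is $K>0$ such that $\|f(x,u)\|\le K(\|x\|+1)$ for all $x\in\mathbb R^n$, $u\in\Gamma$; $h:\mathbb R^n\to\mathbb R^m$ is continuously differentiable. (2) $g:\mathbb R^n\times\mathbb R^m\to\mathbb R^m$ (the output predictor) is continuously differentiable in $(x,u)$. (3) $r(\cdot)$ is continuous and piecewise differentiable; equations containing $\dot r(t+T)$ or derived from it are understood at those $t$ where this derivative exists. Notation. The predicted output is $\hat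 y(t+T):=g(x(t),u(t))$ for $t\ge0$, i.e. $\hat y(t)=g(x(t-T),u(t-T))$ for $t\ge T$. $\dot V$ is the derivative with respect to $t$ along the closed-loop trajectory. $\|\cdot\|$ is the Euclidean norm. A closed-loop trajectory (defined for all $t\ge 0$) is called nonsingular if the partial Jacobian $\frac{\partial g}{\partial u}(x(t),u(t))$ (an $m\times m$ matrix) is nonsingular for every $t\ge0$. *)

(* Defs.v *)
From HB Require Import structures.
From mathcomp Require Export all_boot all_order all_algebra.
From mathcomp Require Export all_classical all_reals all_analysis.
Set Implicit Arguments.
Unset Strict Implicit.
Unset Printing Implicit Defensive.
Import Order.TTheory GRing.Theory Num.Theory.
Import numFieldNormedType.Exports.
Local Open Scope classical_set_scope.
Local Open Scope ring_scope.

(* Euclidean norm; the library norm `|v| on 'rV[R]_k is the sup norm, which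
   induces the same topology. *)
Definition enorm (R : realType) (k : nat) (v : 'rV[R]_k) : R :=
  Num.sqrt (\sum_(i < k) v ord0 i ^+ 2).

(* Frechet differentiable everywhere, with p |-> 'd F p continuous for the
   operator norm. *)
Definition continuously_differentiable (R : realType) (U W : normedModType R)
    (F : U -> W) : Prop :=
  (forall p, differentiable F p) /\
  (forall p (e : R), 0 < e ->
     \forall q \near p, forall v, `|'d F q v - 'd F p v| <= e * `|v|).

(* z has derivative v at t as a function on [0, +oo): the ordinary derivative
   if 0 < t, the right derivative if t = 0. *)
Definition has_derivative_on_ge0 (R : realType) (W : normedModType R)
    (z : R -> W) (t : R) (v : W) : Prop :=
  h^-1 *: (z (t + h) - z t) @[h --> within [set h | 0 <= t + h] 0^'] --> v.

(* Only finitely many breakpoints in each bounded interval; nothing is required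
   of r at the breakpoints. *)
Definition piecewise_differentiable (R : realType) (W : normedModType R)
    (r : R -> W) : Prop :=
  forall b : R, finite_set [set t | 0 < t < b /\ ~ derivable r t 1].

(* Vectors are rows and the library Jacobian acts on the right
   ('d F p v = v *m 'J F p), so these are the transposes of the matrices
   (dg_i/dx_j) and (dg_i/du_j) acting on columns. *)
Definition jacobian_x (R : realType) (n m k : nat)
    (g : 'rV[R]_n * 'rV[R]_m -> 'rV[R]_k) (x : 'rV[R]_n) (u : 'rV[R]_m) :
    'M[R]_(n, k) :=
  jacobian (fun x' => g (x', u)) x.

Definition jacobian_u (R : realType) (n m k : nat)
    (g : 'rV[R]_n * 'rV[R]_m -> 'rV[R]_k) (x : 'rV[R]_n) (u : 'rV[R]_m) :
    'M[R]_(m, k) :=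
  jacobian (fun u' => g (x, u')) u.

Section ClosedLoop.
Variables (R : realType) (n m : nat).
Variables (f : 'rV[R]_n * 'rV[R]_m -> 'rV[R]_n).
Variables (g : 'rV[R]_n * 'rV[R]_m -> 'rV[R]_m).
Variables (r : R -> 'rV[R]_m) (T : R).
Variables (x : R -> 'rV[R]_n) (u : R -> 'rV[R]_m).

Definition linear_growth : Prop :=
  forall Gamma : set 'rV[R]_m, compact Gamma ->
    exists2 K : R, 0 < K &
      forall a b, Gamma b -> enorm (f (a, b)) <= K * (enorm a + 1).

(* Meaningful for T <= s; predicted_output (t + T) = g (x t, u t). *)
Definition predicted_output (s : R) : 'rV[R]_m := g (x (s - T), u (s - T)).

Definition state_equation (x0 : 'rV[R]_n) : Prop :=
  x 0 = x0 /\
  forall t, 0 <= t -> has_derivative_on_ge0 x t (f (x t, u t)).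

(* At the times where r is not differentiable at t + T the differential
   equation is void, hence the explicit continuity of u. *)
Definition controller_equation : Prop :=
  {within [set t | 0 <= t], continuous u} /\
  forall t, 0 <= t -> derivable r (t + T) 1 ->
    has_derivative_on_ge0 u t
      ((r (t + T) - predicted_output (t + T) + derive1 r (t + T)
          - f (x t, u t) *m jacobian_x g (x t) (u t))
       *m invmx (jacobian_u g (x t) (u t))).

Definition nonsingular_trajectory : Prop :=
  forall t, 0 <= t -> jacobian_u g (x t) (u t) \in unitmx.

Definition lyapunov (t : R) : R :=
  2^-1 * enorm (r (t + T) - predicted_output (t + T)) ^+ 2.

End ClosedLoop.

(* Main.v *)
(** The controller is the equation making the predicted output move with
    velocity [r' + err], so the chain rule gives [err' = - err] for the error
    [err t = r (t + T) - g (x t, u t)] wherever [r] is differentiable at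
    [t + T]. This yields [V' = <err, err'> = - 2 V]. For the limit, each
    coordinate of [expR t *: err t] is continuous with zero derivative off a
    locally finite set, hence is constant, so [err t = expR (- t) *: err 0]. *)
Require Import Defs.
From mathcomp Require Import ring.
Set Implicit Arguments.
Unset Strict Implicit.
Unset Printing Implicit Defensive.

Import Order.TTheory GRing.Theory Num.Theory.
Import numFieldNormedType.Exports.
Local Open Scope classical_set_scope.
Local Open Scope ring_scope.

(** * Calculus of one-sided derivatives on the half line *)

Section DerivativeOnHalfLine.
Context {R : realType}.
Implicit Types (W X : normedModType R) (t : R).

(** The increment of [z] is [h] times a difference quotient that converges, so it tends to
    [0 *: v]. *)
Lemma has_derivative_on_ge0_cvg {W} (z : R -> W) t v :
  has_derivative_on_ge0 z t v ->
  z (t + h) @[h --> within [set h | 0 <= t + h] 0^'] --> z t.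
Proof.
move=> dz.
have h0 : (h : R) @[h --> within [set h | 0 <= t + h] 0^'] --> (0 : R).
  apply: (@cvg_trans _ ((h : R) @[h --> (0 : R)^'])).
    exact/cvg_app/cvg_within.
  exact: nbhs_dnbhs.
have cz : z t + h *: (h^-1 *: (z (t + h) - z t))
    @[h --> within [set h | 0 <= t + h] 0^'] --> z t.
  rewrite -[X in _ --> X]addr0 -[X in _ --> z t + X](scale0r v).
  by apply: cvgD; [exact: cvg_cst|exact: cvgZ].
apply: cvg_trans cz; apply: near_eq_cvg.
rewrite near_withinE /=; near=> h => _.
have hn0 : h != 0 by near: h; exact: nbhs_dnbhs_neq.
by rewrite scalerA divff// scale1r addrC subrK.
Unshelve. all: by end_near. Qed.

Lemma has_derivative_on_ge0_continuous {W} (z dz : R -> W) :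
  (forall t, 0 <= t -> has_derivative_on_ge0 z t (dz t)) ->
  {within [set t | 0 <= t], continuous z}.
Proof.
move=> zd; apply/subspace_continuousP => t /= t0.
have /cvgrPdist_lt cz := has_derivative_on_ge0_cvg (zd t t0).
apply/cvgrPdist_lt => e e0; have := cz e e0.
rewrite !near_withinE /= => /nbhs_ballP[d /= d0 dP].
apply/nbhs_ballP; exists d => //= s ts s0.
(* The filter of the derivative is punctured, so the point [s = t] is treated apart. *)
have [->|st] := eqVneq s t; first by rewrite subrr normr0.
have := dP (s - t); rewrite [t + _]addrC subrK; apply => //.
  by move: ts; rewrite -!ball_normE /= sub0r normrN distrC.
by rewrite subr_eq0.
Qed.

(** For [0 < t] the constraint [0 <= t + h] holds as soon as [|h| < t], so near [0] it restricts
    nothing. *)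
Lemma has_derivative_on_ge0_is_derive {W} (z : R -> W) t v :
  0 < t -> has_derivative_on_ge0 z t v -> is_derive t 1 z v.
Proof.
move=> t0 dz.
have cz : h^-1 *: ((z \o shift t) (h *: 1) - z t) @[h --> (0 : R)^'] --> v.
  apply: cvg_trans dz => P wP.
  have {}wP : \forall h \near (0 : R)^',
    0 <= t + h -> P (h^-1 *: (z (t + h) - z t)) by exact: wP.
  suff : \forall h \near (0 : R)^',
    P (h^-1 *: ((z \o shift t) (h *: 1) - z t)) by [].
  near=> h; rewrite /= [h *: 1]mulr1 [h + t]addrC; apply: (near wP h) => //=.
  rewrite -lerBlDl sub0r ltW// ltrNl.
  have : `|h| < t.
    near: h; apply: nbhs_dnbhs; have := @nbhs0_lt R R^o t t0; exact.
  by apply: le_lt_trans; rewrite -normrN ler_norm.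
split; first by apply/cvg_ex; exists v.
exact: cvg_lim.
Unshelve. all: by end_near. Qed.

Lemma derivable_has_derivative_on_ge0_shift {W} (r : R -> W) (T t : R) :
  derivable r (t + T) 1 ->
  has_derivative_on_ge0 (fun s => r (s + T)) t (derive1 r (t + T)).
Proof.
move=> dr.
apply: (@cvg_trans _ (h^-1 *: (r (t + h + T) - r (t + T)) @[h --> (0 : R)^'])).
  exact/cvg_app/cvg_within.
rewrite derive1E; apply: cvg_trans dr; apply: near_eq_cvg; near=> h => /=.
by rewrite [h *: 1]mulr1 addrCA addrA.
Unshelve. all: by end_near. Qed.

Lemma has_derivative_on_ge0B {W} (y z : R -> W) t v w :
  has_derivative_on_ge0 y t v -> has_derivative_on_ge0 z t w ->
  has_derivative_on_ge0 (fun s => y s - z s) t (v - w).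
Proof.
move=> dy dz.
have dyz : h^-1 *: (y (t + h) - y t) - h^-1 *: (z (t + h) - z t)
    @[h --> within [set h | 0 <= t + h] 0^'] --> v - w by exact: cvgB dy dz.
apply: cvg_trans dyz; apply: near_eq_cvg; near=> h => /=.
by rewrite -scalerBr !opprD !opprK addrACA.
Unshelve. all: by end_near. Qed.

Lemma has_derivative_on_ge0_pair {W X} (y : R -> W) (z : R -> X) t v w :
  has_derivative_on_ge0 y t v -> has_derivative_on_ge0 z t w ->
  has_derivative_on_ge0 (fun s => (y s, z s)) t (v, w).
Proof. by move=> dy dz; exact: cvg_pair dy dz. Qed.

(** Chain rule. The increment of [F \o z] is the differential of the increment of [z] plus a
    remainder [rem h]; the first part divided by [h] converges by continuity of ['d F (z t)], and
    [rem h] is [o(h)]. *)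
Lemma has_derivative_on_ge0_comp {W X} (F : W -> X) (z : R -> W) t v :
  differentiable F (z t) -> has_derivative_on_ge0 z t v ->
  has_derivative_on_ge0 (F \o z) t ('d F (z t) v).
Proof.
move=> dF dz.
have [dFc /eqaddoP Fo] := (diff_locallyP _ _).1 dF.
have ddz : 'd F (z t) (h^-1 *: (z (t + h) - z t))
    @[h --> within [set h | 0 <= t + h] 0^'] --> 'd F (z t) v.
  by apply: cvg_comp dz _; exact: dFc.
pose rem h := F (z (t + h)) - (F (z t) + 'd F (z t) (z (t + h) - z t)).
have rem0 : h^-1 *: rem h @[h --> within [set h | 0 <= t + h] 0^'] --> (0 : X).
  apply/cvgrPdist_le => e e0.
  (* [|v| + 1] eventually bounds the difference quotient of [z], so the Frechet remainder is taken
     with tolerance [e / (|v| + 1)]. *)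
  have M0 : 0 < `|v| + 1 by rewrite ltr_wpDl.
  have zt0 : z (t + h) - z t
      @[h --> within [set h | 0 <= t + h] 0^'] --> (0 : W).
    rewrite -[X in _ --> X](subrr (z t)); apply: cvgB; last exact: cvg_cst.
    exact: has_derivative_on_ge0_cvg dz.
  have {}Fo : \forall h \near within [set h | 0 <= t + h] (0 : R)^',
      `|F (z (t + h) - z t + z t) - (F (z t) + 'd F (z t) (z (t + h) - z t))|
      <= e / (`|v| + 1) * `|z (t + h) - z t|.
    exact: (zt0 _ (Fo (e / (`|v| + 1)) (divr_gt0 e0 M0))).
  have /cvgrPdist_le/(_ 1 ltr01) qv := dz.
  near=> h; rewrite sub0r normrN normrZ.
  have : `|rem h| <= e / (`|v| + 1) * `|z (t + h) - z t|.
    by rewrite /rem -{1}(subrK (z t) (z (t + h))); near: h.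
  move=> /(ler_wpM2l (normr_ge0 h^-1))/le_trans; apply.
  rewrite mulrCA -normrZ mulrAC ler_pdivrMr// ler_pM2l//.
  rewrite -[X in `|X|](subrK v) addrC (le_trans (ler_normD _ _))// lerD2l.
  by rewrite distrC; near: h.
have Fz : h^-1 *: rem h + 'd F (z t) (h^-1 *: (z (t + h) - z t))
    @[h --> within [set h | 0 <= t + h] 0^'] --> 'd F (z t) v.
  by rewrite -[X in _ --> X]add0r; exact: cvgD.
apply: cvg_trans Fz; apply: near_eq_cvg; near=> h => /=.
by rewrite linearZ -scalerDr /rem opprD addrA subrK.
Unshelve. all: by end_near. Qed.

End DerivativeOnHalfLine.

(** * Partial Jacobians, exceptional points, coordinates and the squared norm *)

Lemma differential_jacobian_xu (R : realType) (n m k : nat)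
    (g : 'rV[R]_n * 'rV[R]_m -> 'rV[R]_k) (a v : 'rV[R]_n) (b w : 'rV[R]_m) :
  differentiable g (a, b) ->
  'd g (a, b) (v, w) = v *m jacobian_x g a b + w *m jacobian_u g a b.
Proof.
move=> dg; rewrite !mul_rV_lin1.
have -> : 'd (fun a' => g (a', b)) a v = 'd g (a, b) (v, 0).
  rewrite (@diff_comp _ _ _ _ (fun a' : 'rV[R]_n => (a', b)) g a)//=.
  by rewrite diff_pair//= !diff_val.
have -> : 'd (fun b' => g (a, b')) b w = 'd g (a, b) (0, w).
  rewrite (@diff_comp _ _ _ _ (fun b' : 'rV[R]_m => (a, b')) g b)//=.
  by rewrite diff_pair//= !diff_val.
by rewrite -linearD /=; congr ('d g (a, b) (_, _)); rewrite ?addr0 ?add0r.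
Qed.

(** Induction on the list of exceptional points. With none left, the mean value theorem applies; an
    exceptional point [c] inside the interval splits it, and continuity at [c] lets the two halves
    share the value [w c]. *)
Lemma is_derive0_except_finite_eq (R : realType) (w : R -> R) (s : seq R) a b :
  a <= b -> {within `[a, b], continuous w} ->
  (forall t, a < t < b -> t \notin s -> is_derive t 1 w 0) ->
  w a = w b.
Proof.
elim: s a b => [|c s IH] a b ab wc dw.
  move: ab; rewrite le_eqVlt => /predU1P[->//|ab].
  have [|c _ /eqP] := @MVT R w (fun=> 0) a b ab _ wc.
    by move=> t; rewrite in_itv /= => tab; exact: dw.
  by rewrite mul0r subr_eq0 => /eqP ->.
have [/andP[ac cb]|cab] := boolP (a < c < b).
  have sub_ac : `[a, c] `<=` `[a, b].
    by apply: subset_itvl; rewrite bnd_simp ltW.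
  have sub_cb : `[c, b] `<=` `[a, b].
    by apply: subset_itvr; rewrite bnd_simp ltW.
  transitivity (w c); apply: IH; rewrite ?(ltW ac) ?(ltW cb)//.
  - exact: continuous_subspaceW wc.
  - move=> t /andP[at_ tc] ts; apply: dw.
      by rewrite at_ (lt_trans tc).
    by rewrite inE negb_or lt_eqF.
  - exact: continuous_subspaceW wc.
  - move=> t /andP[ct tb] ts; apply: dw.
      by rewrite tb (lt_trans ac).
    by rewrite inE negb_or gt_eqF.
apply: IH => // t tab ts; apply: dw => //.
by rewrite inE negb_or ts andbT; apply: contraNneq cab => <-.
Qed.

Lemma has_derivative_on_ge0_coord (R : realType) (k : nat) (z : R -> 'rV[R]_k)
    (t : R) (v : 'rV[R]_k) i :
  has_derivative_on_ge0 z t v ->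
  has_derivative_on_ge0 (fun s => z s ord0 i) t (v ord0 i).
Proof.
move=> dz.
have dzi : (h^-1 *: (z (t + h) - z t)) ord0 i
    @[h --> within [set h | 0 <= t + h] 0^'] --> v ord0 i.
  apply: (@cvg_comp _ _ _ _ (fun y : 'rV[R]_k => y ord0 i) _ _ _ dz).
  exact: coord_continuous.
apply: cvg_trans dzi; apply: near_eq_cvg; near=> h.
by rewrite !mxE.
Unshelve. all: by end_near. Qed.

(** The square cancels the root, leaving a sum of squares, so a zero of [z] causes no trouble. Each
    difference quotient factors by [a^2 - b^2 = (a + b)(a - b)]. *)
Lemma has_derivative_on_ge0_half_sqr_enorm (R : realType) (k : nat)
    (z : R -> 'rV[R]_k) (t : R) (v : 'rV[R]_k) :
  has_derivative_on_ge0 z t v ->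
  has_derivative_on_ge0 (fun s => 2^-1 * enorm (z s) ^+ 2) t
    (\sum_(i < k) z t ord0 i * v ord0 i).
Proof.
move=> dz.
have sqr_enorm (y : 'rV[R]_k) : enorm y ^+ 2 = \sum_(i < k) y ord0 i ^+ 2.
  by rewrite sqr_sqrtr// sumr_ge0// => i _; exact: sqr_ge0.
have half (a : R) : 2^-1 * (a + a) = a.
  by rewrite -mulr2n -[a *+ 2]mulr_natl mulKf// pnatr_eq0.
have dzi : \sum_(i < k) (2^-1 * (z (t + h) ord0 i + z t ord0 i)) *
      (h^-1 *: (z (t + h) ord0 i - z t ord0 i))
    @[h --> within [set h | 0 <= t + h] 0^']
    --> \sum_(i < k) z t ord0 i * v ord0 i.
  apply: cvg_big; first exact: add_continuous.
  move=> i _; have di := has_derivative_on_ge0_coord (i := i) dz.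
  (* The limit is rewritten as half of a doubled coordinate to match the averaged factor. *)
  rewrite -[z t ord0 i in X in _ --> X]half; apply: cvgM (di); apply: cvgM; first exact: cvg_cst.
  apply: cvgD; last exact: cvg_cst.
  exact: has_derivative_on_ge0_cvg di.
apply: cvg_trans dzi; apply: near_eq_cvg; near=> h => /=.
rewrite !sqr_enorm -mulrBr -sumrB scalerAr scaler_sumr mulr_sumr.
by apply: eq_bigr => i _; rewrite subr_sqr /GRing.scale /=; ring.
Unshelve. all: by end_near. Qed.

(** * Exponential decay of the tracking error *)

Section ClosedLoopConvergence.
Variables (R : realType) (n m : nat).
Variables (f : 'rV[R]_n * 'rV[R]_m -> 'rV[R]_n).
Variables (g : 'rV[R]_n * 'rV[R]_m -> 'rV[R]_m).
Variables (r : R -> 'rV[R]_m) (T : R).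
Variables (x : R -> 'rV[R]_n) (u : R -> 'rV[R]_m) (x0 : 'rV[R]_n).
Hypotheses (T_gt0 : 0 < T) (g_diff : forall p, differentiable g p).
Hypotheses (x_eq : state_equation f x u x0).
Hypotheses (u_eq : controller_equation f g r T x u).

Let err (s : R) : 'rV[R]_m := r (s + T) - predicted_output g T x u (s + T).

Let errE s : err s = r (s + T) - g (x s, u s).
Proof. by rewrite /err /predicted_output addrK. Qed.

Lemma has_derivative_tracking_error t :
  nonsingular_trajectory g x u -> 0 <= t -> derivable r (t + T) 1 ->
  has_derivative_on_ge0 err t (- err t).
Proof.
move=> nonsing t0 dr.
have dxu := has_derivative_on_ge0_pair (x_eq.2 t t0) (u_eq.2 t t0 dr).
have := has_derivative_on_ge0_comp (g_diff (x t, u t)) dxu.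
(* Nonsingularity cancels the inverse Jacobian against [jacobian_u], and the two drift terms in [f]
   cancel; the predicted output moves with velocity [err t] plus the derivative of [r]. *)
rewrite differential_jacobian_xu// mulmxKV ?nonsing// addrC subrK.
move=> /(has_derivative_on_ge0B (derivable_has_derivative_on_ge0_shift dr)).
rewrite opprD addrC -addrA addNr addr0 -/(err t) => de.
by rewrite {1}(funext errE : err = _).
Qed.

(** This covers the breakpoints of [r] too, where no derivative of [u] is given: continuity of [u]
    comes from [controller_equation] itself. *)
Lemma continuous_tracking_error :
  {within [set t | 0 <= t], continuous r} ->
  {within [set t | 0 <= t], continuous err}.
Proof.
move=> /subspace_continuousP rc.
have /subspace_continuousP xc := has_derivative_on_ge0_continuous x_eq.2.
have /subspace_continuousP uc := u_eq.1.
rewrite (funext errE); apply/subspace_continuousP => t t0; apply: cvgB.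
  (* Continuity of [r] is relative to the half line, which the shift by [T > 0] maps into itself. *)
  have tT : 0 <= t + T by rewrite addr_ge0// ltW.
  have /cvgrPdist_lt rt := rc _ tT.
  apply/cvgrPdist_lt => e e0; have := rt e e0.
  rewrite !near_withinE /= => /nbhs_ballP[d /= d0 dP].
  apply/nbhs_ballP; exists d => //= s ts s0; apply: dP => /=.
    by move: ts; rewrite -!ball_normE /= opprD addrACA subrr addr0.
  by rewrite addr_ge0// ltW.
have gc : {for (x t, u t), continuous g} by exact: differentiable_continuous.
apply: (@cvg_comp _ _ _ (fun s => (x s, u s)) g _ (nbhs (x t, u t))) => //.
exact: (cvg_pair (xc t t0) (uc t t0)).
Qed.

Lemma tracking_error_expR t :
  {within [set t | 0 <= t], continuous r} -> piecewise_differentiable r ->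
  nonsingular_trajectory g x u -> 0 <= t -> err t = expR (- t) *: err 0.
Proof.
move=> r_cont r_pdiff nonsing t0.
apply/rowP => i; rewrite [RHS]mxE.
have [s sP] := (finite_seqP _).1 (r_pdiff (t + T)).
(* Integrating factor: [err' = - err] makes the derivative of [w] vanish. *)
pose w a := expR a * err a ord0 i.
suff : w 0 = w t.
  rewrite /w expR0 mul1r => ->.
  by rewrite mulrA -expRD addNr expR0 mul1r.
(* [s] lists the breakpoints of [r] in [(0, t + T)]; the error at time [a] sees [r] at [a + T],
   hence the translation by [- T]. *)
apply: (@is_derive0_except_finite_eq _ w [seq a - T | a <- s]) => //.
  have ec := continuous_tracking_error r_cont.
  have {}ec : {within `[0, t], continuous err}.
    by apply: continuous_subspaceW ec => a /=; rewrite in_itv /= => /andP[].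
  move=> a; apply: cvgM.
    by apply: continuous_subspaceT; exact: continuous_expR.
  apply: (@cvg_comp _ _ _ err (fun y : 'rV[R]_m => y ord0 i) _ _ _ (ec a)).
  exact: coord_continuous.
move=> a /andP[a0 at_] as_.
have dr : derivable r (a + T) 1.
  apply: contrapT => ndr; move/negP: as_; apply.
  apply/mapP; exists (a + T); last by rewrite addrK.
  have : [set` s] (a + T) by rewrite -sP /= ltrD2r at_ addr_gt0.
  by [].
have /(has_derivative_on_ge0_coord (i := i)) de :=
  has_derivative_tracking_error nonsing (ltW a0) dr.
have {}de := has_derivative_on_ge0_is_derive a0 de.
apply: is_derive_eq; rewrite [(- err a) ord0 i]mxE /GRing.scale /=; ring.
Qed.

End ClosedLoopConvergence.

Theorem proposition3p1 (R : realType) (n m : nat)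
    (f : 'rV[R]_n * 'rV[R]_m -> 'rV[R]_n)
    (h : 'rV[R]_n -> 'rV[R]_m)
    (g : 'rV[R]_n * 'rV[R]_m -> 'rV[R]_m)
    (r : R -> 'rV[R]_m) (T : R) (x0 : 'rV[R]_n)
    (x : R -> 'rV[R]_n) (u : R -> 'rV[R]_m)
    (T_gt0 : 0 < T)
    (f_C1 : continuously_differentiable f)
    (f_growth : linear_growth f)
    (h_C1 : continuously_differentiable h)
    (g_C1 : continuously_differentiable g)
    (r_cont : {within [set t : R | 0 <= t], continuous r})
    (r_pdiff : piecewise_differentiable r)
    (x_eq : state_equation f x u x0)
    (u_eq : controller_equation f g r T x u)
    (nonsing : nonsingular_trajectory g x u) :
  (forall t : R, 0 <= t -> derivable r (t + T) 1 ->
     has_derivative_on_ge0 (lyapunov g r T x u) t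
       (- 2 * lyapunov g r T x u t)) /\
  r t - predicted_output g T x u t @[t --> +oo] --> (0 : 'rV[R]_m).
Proof.
split=> [t t0 dr|].
  have := has_derivative_on_ge0_half_sqr_enorm
    (has_derivative_tracking_error g_C1.1 x_eq u_eq nonsing t0 dr).
  congr has_derivative_on_ge0.
  (* What remains is that pairing the error with its negative gives minus its squared norm, which is
     [- 2 V]. *)
  rewrite /lyapunov mulNr mulrA divff ?pnatr_eq0// mul1r sqr_sqrtr.
    by rewrite -sumrN; apply: eq_bigr => i _; rewrite !mxE; ring.
  by rewrite sumr_ge0// => i _; exact: sqr_ge0.
pose e0 := r (0 + T) - predicted_output g T x u (0 + T).
(* The error compared at time [t] is the tracking error of time [t - T], hence the constant factor
   [expR T]; this reading requires [T <= t], which holds eventually. *)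
have lim0 : expR (- t) *: (expR T *: e0) @[t --> +oo] --> (0 : 'rV[R]_m).
  rewrite -[X in _ --> X](scale0r (expR T *: e0)).
  by apply: cvgZ; [exact: cvgr_expR|exact: cvg_cst].
apply: cvg_trans lim0; apply: near_eq_cvg; near=> t.
have tT : 0 <= t - T by rewrite subr_ge0; near: t; exact: nbhs_pinfty_ge (num_real _).
have := tracking_error_expR T_gt0 g_C1.1 x_eq u_eq r_cont r_pdiff nonsing tT.
by rewrite subrK => ->; rewrite scalerA -expRD opprB addrC.
Unshelve. all: by end_near. Qed.
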